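(* For all cardinals $\kappa,\lambda\geq 1$ such that there is a $(\kappa,\lambda)$-gap in $\mathcal{P}(\omega)/\mathsf{fin}$, there is a $(\kappa,\lambda)$-gap in the Wadge quasi-order on the Borel subsets of the real line.
   Context: For subsets $A,B$ of $\mathbb{R}$, $A\leq B$ means that there is a continuous function $f\colon\mathbb{R}\to\mathbb{R}$ with $A=f^{-1}(B)$; this is the Wadge quasi-order for the real line, here restricted to Borel sets. $\mathcal{P}(\omega)/\mathsf{fin}$ is regarded as the quasi-order on $\mathcal{P}(\omega)$ given by $a\subseteq_{\mathsf{fin}}b$ iff $a\setminus b$ is finite. In a quasi-order, $x<y$ means $x\leq y$ and not $y\leq x$. If $X$ and $Y$ are nonempty subsets of a quasi-order, the pair $(X,Y)$ is a gap if $x<y$ for all $x\in X$ and $y\in Y$ and there is no $z$ in the quasi-order with $x<z<y$ for all $x\in X$ and $y\in Y$. A $(\kappa,\lambda)$-gap is a gap $(X,Y)$ such that $X=\{x_\alpha\mid\alpha<\kappa\}$ for a strictly increasing sequence $\langle x_\alpha\mid\alpha<\kappa\rangle$ and $Y=\{y_\beta\mid\beta<\lambda\}$ for a strictly decreasing sequence $\langle y_\beta\mid\beta<\lambda\rangle$. *)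

(* Defs.v *)
From mathcomp Require Import all_boot all_order all_algebra.
From mathcomp Require Import all_classical wochoice all_reals all_analysis.

Set Implicit Arguments.
Unset Strict Implicit.
Unset Printing Implicit Defensive.

Import numFieldNormedType.Exports.

Local Open Scope classical_set_scope.
Local Open Scope card_scope.

Section QuasiOrder.
Variables (T : Type) (le : T -> T -> Prop).

Definition strict (x y : T) : Prop := le x y /\ ~ le y x.

Definition is_gap (X Y : set T) : Prop :=
  [/\ X !=set0, Y !=set0,
      (forall x y, X x -> Y y -> strict x y) &
      ~ exists z, forall x y, X x -> Y y -> strict x z /\ strict z y].

End QuasiOrder.

(* [leK] is the reflexive order; as it is total, [a] is strictly below [b]
   exactly when [~~ leK b a]. *)
Definition wo_lt (K : Type) (leK : rel K) (a b : K) : bool := ~~ leK b a.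

(* Cardinals are initial ordinals, and an ordinal is represented by a
   well-ordered type: the order is a cardinal when no proper initial segment
   has the cardinality of the whole type. *)
Definition is_cardinal (K : Type) (leK : rel K) : Prop :=
  well_order leK /\ forall a : K, ~ ([set: K] #<= [set b | wo_lt leK b a]).

Definition is_card_gap (K : Type) (leK : rel K) (L : Type) (leL : rel L)
    (T : Type) (le : T -> T -> Prop) (X Y : set T) : Prop :=
  [/\ is_gap le X Y,
      (exists x : K -> T, X = range x /\
         forall a b, wo_lt leK a b -> strict le (x a) (x b)) &
      (exists y : L -> T, Y = range y /\
         forall a b, wo_lt leL a b -> strict le (y b) (y a))].

Definition sub_fin (a b : set nat) : Prop := finite_set (a `\` b).

Definition borel_set (R : realType) : Type :=
  {A : set R | <<s [set U : set R | open U] >> A}.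

Definition wadge_le (R : realType) (A B : borel_set R) : Prop :=
  exists f : R -> R, continuous f /\ sval A = f @^-1` sval B.

Lemma sub_fin_refl a : sub_fin a a.
Proof. by rewrite /sub_fin setDv; exact: finite_set0. Qed.

Lemma sub_fin_trans a b c : sub_fin a b -> sub_fin b c -> sub_fin a c.
Proof.
move=> ab bc; apply: (@sub_finite_set _ _ ((a `\` b) `|` (b `\` c))).
  by move=> n [an cn]; have [bn|bn] := pselect (b n); [right|left].
by rewrite finite_setU; split.
Qed.

Lemma wadge_le_refl (R : realType) (A : borel_set R) : wadge_le A A.
Proof. by exists id; split=> // x; exact: cvg_id. Qed.

Lemma wadge_le_trans (R : realType) (A B C : borel_set R) :
  wadge_le A B -> wadge_le B C -> wadge_le A C.
Proof.
move=> [f [fc AB]] [g [gc BC]]; exists (g \o f); split; last by rewrite AB BC.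
by move=> x; apply: continuous_comp; [exact: fc | exact: gc].
Qed.

(* Main.v *)
Require Import Defs.
From mathcomp Require Import all_boot all_order all_algebra.
From mathcomp Require Import all_classical wochoice all_reals all_analysis.
From mathcomp Require Import zify ring lra.

(* A predicate [P] on the integers is coded by the set [wset e P] that contains
   the point [e i] when [P i] and the open interval [(e i, e (i + 1))] when not
   [P i].  As a continuous reduction has the intermediate value property, it can
   only walk through the letters of the target while reading those of the
   source.  If the letters satisfying [P], the marks, are isolated, such a walk
   is forced to go from each mark to the next one, so reducibility says that,
   after a shift of the index, the distances between consecutive marks do not
   increase.  Distances that are constant, equal to [2n + 2] or [2n + 3] as [n]
   is in [a] or not, on blocks of length about [4 ^ n], absorb every finite
   shift; this embeds P(omega)/fin.

   The sets of this form with isolated marks are convex: if [C] lies between two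
   of them, the reduction [g] to [C] goes from one end of the line to the other,
   and its values at the integers cut the line into intervals that are contained
   in or disjoint from [C].  So a set filling the image of a gap would yield a
   distance sequence, and from that sequence one reads off a subset of [omega]
   filling the original gap. *)

Set Implicit Arguments.
Unset Strict Implicit.
Unset Printing Implicit Defensive.

Import Order.TTheory GRing.Theory Num.Theory.
Import numFieldNormedType.Exports.

Local Open Scope classical_set_scope.
Local Open Scope ring_scope.

(** * Sets coded by words on a grid *)

Section Grids.
Variable R : realType.
Implicit Types (e : int -> R) (P : int -> bool) (f g : R -> R) (t : R).

Lemma continuous_IVT f a b v : continuous f -> a <= b ->
  f a <= v <= f b \/ f b <= v <= f a -> exists c, a <= c <= b /\ f c = v.
Proof.
move=> fc ab fv; have [|c] := @IVT R f a b v ab (continuous_subspaceT fc).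
  by case: fv => /andP[h1 h2]; rewrite ge_min le_max h1 h2 ?orbT.
by rewrite in_itv/= => cab <-; exists c.
Qed.

(** The second clause makes the sequence unbounded in both directions and rules out accumulation
    points. *)
Definition grid e := (forall i : int, e i < e (i + 1)) /\
  forall t, exists i : int, e i <= t < e (i + 1).

Definition wset e P : set R :=
  [set t | exists i : int, P i /\ t = e i \/ ~~ P i /\ e i < t < e (i + 1)].

Definition reduces f (A B : set R) := continuous f /\ A = f @^-1` B.

Lemma reducesE f A B : reduces f A B -> forall t, A t <-> B (f t).
Proof. by case=> _ ->. Qed.

Lemma grid_le e i j : grid e -> i <= j -> e i <= e j.
Proof.
move=> [ge _] ij; have -> : j = i + (`|j - i|%N)%:Z by lia.
elim: `|j - i|%N => [|n IH]; first by rewrite addr0.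
have -> : i + n.+1%:Z = i + n%:Z + 1 by lia.
exact: le_trans IH (ltW (ge _)).
Qed.

Lemma grid_lt e i j : grid e -> i < j -> e i < e j.
Proof.
move=> ge ij; apply: lt_le_trans (ge.1 i) _; apply: grid_le => //; lia.
Qed.

Lemma grid_lt_inv e i j : grid e -> e i < e j -> i < j.
Proof.
by move=> ge eij; rewrite ltNge; apply/negP => /(grid_le ge); rewrite leNgt eij.
Qed.

Lemma grid_le_inv e i j : grid e -> e i <= e j -> i <= j.
Proof.
by move=> ge eij; rewrite leNgt; apply/negP => /(grid_lt ge); rewrite ltNge eij.
Qed.

Lemma grid_idx_uniq e i j t : grid e -> e i <= t < e (i + 1) ->
  e j <= t < e (j + 1) -> i = j.
Proof.
move=> ge /andP[h1 h2] /andP[h3 h4].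
have := grid_lt_inv ge (le_lt_trans h1 h4).
have := grid_lt_inv ge (le_lt_trans h3 h2).
lia.
Qed.

Lemma grid_cases e t : grid e ->
  (exists i, t = e i) \/ exists i, e i < t < e (i + 1).
Proof.
move=> [_ /(_ t)[i /andP[]]]; rewrite le_eqVlt => /predU1P[<-|h1] h2.
  by left; exists i.
by right; exists i; rewrite h1 h2.
Qed.

Lemma wset_point e P i : grid e -> wset e P (e i) <-> P i.
Proof.
move=> ge; split=> [[j [[Pj]|[_ /andP[h1 h2]]]]|Pi]; last by exists i; left.
  move=> eij; have -> : i = j; last by [].
  by apply/eqP; rewrite eq_le !(grid_le_inv ge) // eij.
by have := grid_lt_inv ge h1; have := grid_lt_inv ge h2; lia.
Qed.

Lemma wset_itv e P i t : grid e -> e i < t < e (i + 1) ->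
  wset e P t <-> ~~ P i.
Proof.
move=> ge /andP[h1 h2]; split=> [[j [[Pj tE]|[Pj /andP[h3 h4]]]]|Pi].
- rewrite tE in h1 h2.
  by have := grid_lt_inv ge h1; have := grid_lt_inv ge h2; lia.
- have -> : i = j; last by [].
  by apply: (@grid_idx_uniq e i j t) => //; rewrite ?h2 ?h4 ltW.
- by exists i; right; rewrite h1 h2.
Qed.

Lemma glue e (h : int -> R -> R) : grid e -> (forall i, continuous (h i)) ->
  (forall i, h i (e (i + 1)) = h (i + 1) (e (i + 1))) ->
  exists f, continuous f /\ forall i t, e i <= t <= e (i + 1) -> f t = h i t.
Proof.
move=> ge hc hE; have /choice[idx idxP] := ge.2.
pose f t := h (idx t) t.
have fE i t : e i <= t <= e (i + 1) -> f t = h i t.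
  move=> /andP[h1]; rewrite le_eqVlt => /predU1P[tE|h2].
    rewrite /f (@grid_idx_uniq e (idx t) (i + 1) t) ?idxP//.
      by rewrite tE hE.
    by rewrite tE lexx ge.1.
  by rewrite /f (@grid_idx_uniq e (idx t) i t) ?idxP// h1 h2.
exists f; split=> // t; have /andP[h1 h2] := idxP t; set n := idx t in h1 h2.
(* Near [t] only the pieces [n - 1] and [n] matter. The cut-offs by [max] and [min] splice them at
   [e n] in one continuous formula; the last term cancels the piece frozen at [e n]. *)
pose k s := h n (Num.max s (e n)) + h (n - 1) (Num.min s (e n)) - h n (e n).
have kc : continuous k.
  move=> s; apply: cvgB; last exact: cvg_cst.
  apply: cvgD.
    apply: (@continuous_comp _ _ _ (fun s => Num.max s (e n)) (h n));
      last exact: hc.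
    by apply: (@continuous_max _ _ id (cst (e n)));
      [exact: cvg_id|exact: cvg_cst].
  apply: (@continuous_comp _ _ _ (fun s => Num.min s (e n)) (h (n - 1)));
    last exact: hc.
  by apply: (@continuous_min _ _ id (cst (e n)));
    [exact: cvg_id|exact: cvg_cst].
have hEn : h (n - 1) (e n) = h n (e n).
  by have := hE (n - 1); rewrite subrK.
have fk s : e (n - 1) < s < e (n + 1) -> k s = f s.
  move=> /andP[s1 s2]; rewrite /k; case: (leP s (e n)) => sn.
    rewrite (fE (n - 1)); last by rewrite subrK sn ltW.
    by rewrite addrAC subrr add0r.
  by rewrite (fE n) ?(ltW sn) ?ltW// hEn addrK.
have nt : e (n - 1) < t < e (n + 1).
  by rewrite h2 andbT (lt_le_trans _ h1)// grid_lt//; lia.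
have /= := kc t; rewrite /continuous_at (fk t nt); apply: cvg_trans.
apply: near_eq_cvg.
have : t \in `]e (n - 1), e (n + 1)[ by rewrite in_itv.
by move=> /near_in_itvoo; apply: filterS => s; rewrite in_itv/= => /fk.
Qed.

(* A piece of the source may bounce inside the letter to the right of [e' (phi i)],
   but it can only step back through the letter [phi i - 1] if this is the letter
   being read. *)
Definition walk P P' (phi : int -> int) := forall i : int, P i = P' (phi i) /\
  [\/ phi (i + 1) = phi i + 1, phi (i + 1) = phi i |
      phi (i + 1) = phi i - 1 /\ P' (phi i - 1) = P i].

Lemma walk_reduces e P e' P' phi : grid e -> grid e' -> walk P P' phi ->
  exists f, reduces f (wset e P) (wset e' P').
Proof.
move=> ge ge' wphi.
pose u i t := (t - e i) / (e (i + 1) - e i).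
pose y i := e' (phi i).
(* If the index stays, the piece is a tent that enters the interval to the right of [y i] and
   returns. Otherwise it is affine, and a step back runs through the interval of the letter
   [phi i - 1]. *)
pose h i t := if phi (i + 1) == phi i
  then y i + Num.min (u i t) (1 - u i t) * (e' (phi i + 1) - y i)
  else y i + u i t * (y (i + 1) - y i).
have d_gt0 i : 0 < e (i + 1) - e i by rewrite subr_gt0 ge.1.
have u0 i : u i (e i) = 0 by rewrite /u subrr mul0r.
have u1 i : u i (e (i + 1)) = 1 by rewrite /u divff// gt_eqF.
have uc i : continuous (u i).
  move=> t; apply: cvgM; last exact: cvg_cst.
  by apply: cvgB; [exact: cvg_id|exact: cvg_cst].
have hc i : continuous (h i).
  move=> t; rewrite /h; case: (phi (i + 1) == phi i).
    apply: cvgD; first exact: cvg_cst.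
    apply: cvgM; last exact: cvg_cst.
    apply: (@continuous_min _ _ (u i) (fun t => 1 - u i t)); first exact: uc.
    by apply: cvgB; [exact: cvg_cst|exact: uc].
  apply: cvgD; first exact: cvg_cst.
  by apply: cvgM; [exact: uc|exact: cvg_cst].
have h0 i : h i (e i) = y i.
  by rewrite /h u0 subr0 minElt ltr01 !mul0r addr0 if_same.
have h1 i : h i (e (i + 1)) = y (i + 1).
  rewrite /h u1 subrr minElt ltr10 mul0r addr0 mul1r /y.
  by case: eqP => [->//|_]; lra.
have [f [fc fE]] := glue ge hc (fun i => etrans (h1 i) (esym (h0 (i + 1)))).
exists f; split=> //; apply/seteqP.
suff H t : wset e P t <-> wset e' P' (f t) by split=> t /H.
have [[i ->]|[i tI]] := grid_cases t ge.
  rewrite (fE i) ?lexx ?ltW ?ge.1// h0.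
  by rewrite !wset_point// (wphi i).1.
have /andP[t1 t2] := tI.
rewrite (fE i) ?ltW// (wset_itv _ ge tI).
have u_gt0 : 0 < u i t by apply: divr_gt0; rewrite ?subr_gt0 ?ge.1.
have u_lt1 : u i t < 1 by rewrite ltr_pdivrMr// mul1r ltrD2r.
have [PE step] := wphi i.
rewrite /h; case: eqP step => [_ _|ne step].
  rewrite PE; have Hd := ge'.1 (phi i).
  apply: iff_sym; apply: wset_itv => //; rewrite -/(y i).
  set m := Num.min _ _; have m0 : 0 < m by rewrite lt_min u_gt0 subr_gt0.
  have m1 : m < 1 by rewrite gt_min u_lt1.
  rewrite -/(y i) in Hd.
  apply/andP; split; nra.
apply: iff_sym; case: step => [sE|//|[sE <-]].
  rewrite PE; apply: wset_itv => //.
  have Hd := ge'.1 (phi i); rewrite /y sE; apply/andP; split; nra.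
apply: wset_itv => //; rewrite subrK.
have Hd := ge'.1 (phi i - 1); rewrite subrK in Hd.
rewrite /y sE; apply/andP; split; nra.
Qed.

End Grids.

(** * Reductions between coded sets as walks *)

Section Walks.
Variable R : realType.
Implicit Types (e : int -> R) (P : int -> bool) (f g : R -> R) (t : R).

(** A grid point and the interval just to its right disagree about membership, whatever the letter
    is. *)
Lemma grid_point_boundary e P i (Q : Prop) : grid e ->
  ~ \forall s \near e i, wset e P s <-> Q.
Proof.
move=> ge near; have Qi := nbhs_singleton near.
move: near => /nbhs_ballP[d /= d0 dP]; have H := ge.1 i.
pose s := Num.min (e i + d / 2) ((e i + e (i + 1)) / 2).
have s1 : e i < s by rewrite lt_min; apply/andP; split; lra.
have s2 : s < e (i + 1) by rewrite gt_min; apply/orP; right; lra.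
have : ball (e i) d s.
  have : s <= e i + d / 2 by rewrite ge_min lexx.
  by rewrite /ball/= ltr_norml => s3; apply/andP; split; lra.
have sI : e i < s < e (i + 1) by rewrite s1.
move=> /dP; rewrite (wset_itv P ge sI); move: Qi; rewrite wset_point//.
by rewrite /is_true; case: (P i) => /=; intuition discriminate.
Qed.

Lemma near_locally_constant e P e' P' f t m : grid e' ->
  continuous f -> (forall t, wset e P t <-> wset e' P' (f t)) ->
  e' m < f t < e' (m + 1) -> \forall s \near t, wset e P s <-> ~~ P' m.
Proof.
move=> ge' fc fP fm; have fI : f t \in `]e' m, e' (m + 1)[ by rewrite in_itv.
have fN := fc t _ (near_in_itvoo fI).
apply: (@filterS _ (nbhs t) _ _ _ _ fN) => s.
by rewrite /preimage/= in_itv/= => sI; rewrite fP; exact: wset_itv.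
Qed.

Lemma reduction_grid e P e' P' f i : grid e -> grid e' ->
  reduces f (wset e P) (wset e' P') ->
  exists m, P i = P' m /\ f (e i) = e' m.
Proof.
move=> ge ge' fr; have fP := reducesE fr.
have [[m fm]|[m fm]] := grid_cases (f (e i)) ge'.
  exists m; split=> //; apply/idP/idP => H.
    by apply/(wset_point _ _ ge'); rewrite -fm -fP; apply/wset_point.
  by apply/(wset_point _ _ ge); rewrite fP fm; apply/wset_point.
by case: (grid_point_boundary ge (near_locally_constant ge' fr.1 fP fm)).
Qed.

(** Membership is constant on the open source interval. To escape past a neighbouring grid point,
    [f] would have to visit from there both that point and the interval to its right, which
    disagree. *)
Lemma reduction_bound e P e' P' f i m t : grid e -> grid e' ->
  reduces f (wset e P) (wset e' P') -> f (e i) = e' m ->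
  e i <= t <= e (i + 1) -> e' (m - 1) <= f t <= e' (m + 1).
Proof.
move=> ge ge' fr fm /andP[t1 t2]; have fP := reducesE fr.
have H1 := ge'.1 m; have H2 := ge'.1 (m + 1).
have H0 := ge'.1 (m - 1); rewrite subrK in H0.
have contra (c1 c2 : R) n : e i < c1 < e (i + 1) -> e i < c2 < e (i + 1) ->
    f c1 = e' n -> e' n < f c2 < e' (n + 1) -> False.
  move=> /(wset_itv P ge) C1 /(wset_itv P ge) C2 E1 /(wset_itv P' ge') E2.
  have := wset_point P' n ge'; rewrite -E1 -fP C1.
  move: C2; rewrite fP E2.
  by rewrite /is_true; case: (P i) (P' n) => [] [] /=; intuition discriminate.
apply/andP; split; rewrite leNgt; apply/negP => lt.
  have [||c1 [/andP[c11 c12] c1E]] :=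
    @continuous_IVT R f (e i) t (e' (m - 1)) fr.1.
  - by [].
  - by right; rewrite fm; apply/andP; split; lra.
  have ne1 : c1 != e i by apply/eqP => c1e; move: c1E; rewrite c1e fm; lra.
  have ne2 : c1 != t by apply/eqP => c1e; move: lt; rewrite -c1e c1E ltxx.
  have [||c2 [/andP[c21 c22] c2E]] :=
    @continuous_IVT R f (e i) c1 ((e' (m - 1) + e' m) / 2) fr.1.
  - by [].
  - by right; rewrite fm c1E; apply/andP; split; lra.
  have ne3 : c2 != e i by apply/eqP => c1e; move: c2E; rewrite c1e fm; lra.
  have ne4 : c2 != c1 by apply/eqP => c1e; move: c2E; rewrite c1e c1E; lra.
  apply: (contra c1 c2 (m - 1)) => //.
  - by rewrite lt_neqAle eq_sym ne1 c11; apply: lt_le_trans t2;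
    rewrite lt_neqAle ne2.
  - rewrite lt_neqAle eq_sym ne3 c21; apply: lt_le_trans t2.
    by apply: le_lt_trans c22 _; rewrite lt_neqAle ne2.
  - by rewrite c2E subrK; apply/andP; split; lra.
have [||c1 [/andP[c11 c12] c1E]] :=
  @continuous_IVT R f (e i) t (e' (m + 1)) fr.1.
- by [].
- by left; rewrite fm; apply/andP; split; lra.
have ne1 : c1 != e i by apply/eqP => c1e; move: c1E; rewrite c1e fm; lra.
have ne2 : c1 != t by apply/eqP => c1e; move: lt; rewrite -c1e c1E ltxx.
pose w := (e' (m + 1) + Num.min (f t) (e' (m + 1 + 1))) / 2.
have [w1 w2 w3] : [/\ e' (m + 1) < w, w < f t & w < e' (m + 1 + 1)].
  by rewrite /w; case: (leP (f t) (e' (m + 1 + 1))) => ?; split; lra.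
have [||c2 [/andP[c21 c22] c2E]] := @continuous_IVT R f c1 t w fr.1.
- by [].
- by left; rewrite c1E; apply/andP; split; lra.
have ne3 : c2 != c1 by apply/eqP => c1e; move: c2E; rewrite c1e c1E; lra.
have ne4 : c2 != t by apply/eqP => c1e; move: c2E; rewrite c1e; lra.
apply: (contra c1 c2 (m + 1)) => //.
- by rewrite lt_neqAle eq_sym ne1 c11; apply: lt_le_trans t2;
  rewrite lt_neqAle ne2.
- have c12' : c1 < c2 by rewrite lt_neqAle eq_sym ne3.
  have c2t : c2 < t by rewrite lt_neqAle ne4.
  by rewrite (le_lt_trans c11 c12') (lt_le_trans c2t t2).
- by rewrite c2E w1.
Qed.

Lemma reduction_walk e P e' P' f : grid e -> grid e' ->
  reduces f (wset e P) (wset e' P') ->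
  exists2 phi, walk P P' phi & forall i, f (e i) = e' (phi i).
Proof.
move=> ge ge' fr; have fP := reducesE fr.
have /choice[phi phiP] := fun i => reduction_grid i ge ge' fr.
exists phi => i; last by case: (phiP i).
have [PE fE] := phiP i; split=> //.
have := reduction_bound (t := e (i + 1)) ge ge' fr fE.
rewrite lexx ltW ?ge.1// (phiP (i + 1)).2 => /(_ isT)/andP[].
move=> /(grid_le_inv ge') h1 /(grid_le_inv ge') h2.
have [|[|h]] : phi (i + 1) = phi i + 1 \/ phi (i + 1) = phi i
    \/ phi (i + 1) = phi i - 1 by lia.
- by constructor 1.
- by constructor 2.
constructor 3; split=> //.
(* A step back crosses the midpoint of the interval of the letter [phi i - 1]; the interior point
   [c] where this happens identifies that letter with [P i]. *)
have H := ge'.1 (phi i - 1); rewrite subrK in H.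
have [||c [/andP[c1 c2] cE]] :=
  @continuous_IVT R f (e i) (e (i + 1)) ((e' (phi i - 1) + e' (phi i)) / 2) fr.1.
- exact/ltW/ge.1.
- by right; rewrite fE (phiP (i + 1)).2 h; apply/andP; split; lra.
have ne1 : c != e i by apply/eqP => ce; move: cE; rewrite ce fE; lra.
have ne2 : c != e (i + 1).
  by apply/eqP => ce; move: cE; rewrite ce (phiP (i + 1)).2 h; lra.
have C1 : e i < c < e (i + 1) by rewrite !lt_neqAle eq_sym ne1 ne2 c1.
have C2 : e' (phi i - 1) < f c < e' (phi i - 1 + 1).
  by rewrite subrK cE; apply/andP; split; lra.
have := wset_itv P ge C1; rewrite fP (wset_itv P' ge' C2).
by rewrite /is_true; case: (P i) (P' _) => [] [] /=; intuition discriminate.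
Qed.

End Walks.

(** * Convexity *)

Section Divergence.
Variable R : realType.
Implicit Types (e : int -> R) (P : int -> bool) (f g : R -> R) (t : R).

Lemma last_crossing g s t a : continuous g -> s <= t -> g s <= a <= g t ->
  exists u, [/\ s <= u <= t, g u = a & forall w, u < w <= t -> a < g w].
Proof.
move=> gc st /andP[gs gt].
pose S := [set w | s <= w <= t /\ g w <= a].
have Ss : S s by split=> //; rewrite lexx.
have ubS : has_ubound S by exists t => w [/andP[]].
have leS w : S w -> w <= sup S by exact: (ub_le_sup ubS).
have supt : sup S <= t by apply: ge_sup; [exists s|move=> w [/andP[]]].
have gu : g (sup S) <= a.
  rewrite leNgt; apply/negP => lt.
  have gI : g (sup S) \in `]a, g (sup S) + 1[
    by rewrite in_itv/= lt ltrDl ltr01.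
  have /nbhs_ballP[d /= d0 dP] := gc (sup S) _ (near_in_itvoo gI).
  have [|w Sw wlt] := @sup_adherent R S d d0; first by split=> //; exists s.
  have wle := leS w Sw.
  have : ball (sup S) d w by rewrite /ball/= ltr_norml; apply/andP; split; lra.
  by move=> /dP; rewrite /= in_itv/= ltNge Sw.2.
have su := leS s Ss.
have gE : g (sup S) = a.
  have [|c [/andP[c1 c2] cE]] := @continuous_IVT R g (sup S) t a gc supt.
    by left; rewrite gu.
  have Sc : S c by split; rewrite ?cE// (le_trans su c1).
  by have -> : sup S = c by apply/le_anti; rewrite c1 leS.
exists (sup S); split=> //; first by rewrite su.
move=> w /andP[uw wt]; rewrite ltNge; apply/negP => gw.
have : S w by split=> //; rewrite wt (le_trans su (ltW uw)).
by move=> /leS; rewrite leNgt uw.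
Qed.

Lemma crossing g s t a b : continuous g -> s <= t -> g s <= a -> a < b ->
  b <= g t -> exists u v, [/\ u < v, g u = a, g v = b &
    forall w, u < w < v -> a < g w < b].
Proof.
move=> gc st gs ab gt.
have [|u [/andP[su ut] gu guP]] := last_crossing gc st (a := a).
  by rewrite gs (le_trans (ltW ab)).
(* Point reflection turns the first arrival at [b] after [u] into a last crossing. *)
have gc' : continuous (fun w => - g (- w)).
  move=> w; apply: cvgN; apply: continuous_comp; [exact: cvgN|exact: gc].
have [||v [/andP[v1 v2] gv gvP]] := @last_crossing _ (- t) (- u) (- b) gc'.
- by rewrite lerN2.
- by rewrite !opprK !lerN2 gt gu ltW.
exists u, (- v).
have gvb : g (- v) = b by apply: oppr_inj; rewrite gv.
have uv : u <= - v by rewrite lerNr.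
split=> //.
  rewrite lt_neqAle uv andbT; apply/eqP => uE.
  by move: gvb; rewrite -uE gu => E; rewrite E ltxx in ab.
move=> w /andP[w1 w2]; apply/andP; split.
  by apply: guP; rewrite w1/= (le_trans (ltW w2))// lerNl.
have := gvP (- w); rewrite opprK ltrN2; apply.
by rewrite ltrNr w2 lerN2 ltW.
Qed.

Definition diverges (T : porderZmodType) (x : T -> R) := forall M, exists N,
  forall n, (N <= n -> M <= x n) /\ (n <= - N -> x n <= - M).

Lemma continuous_bounded f M : continuous f ->
  exists B, forall s, `|s| <= M -> `|f s| <= B.
Proof.
move=> fc; have [M0|M0] := ltP M 0.
  exists 0 => s sM; have := le_lt_trans sM M0.
  by rewrite normr_lt0.
have MM : - M <= M by lra.
have [c _ cP] := @EVT_max R f (- M) M MM (continuous_subspaceT fc).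
have [d _ dP] := @EVT_min R f (- M) M MM (continuous_subspaceT fc).
exists (`|f c| + `|f d|) => s; rewrite ler_norml => sM.
have := cP s; have := dP s; rewrite in_itv/= => /(_ sM) h1 /(_ sM) h2.
have := ler_norm (f c); have := ler_norm (- f d); rewrite normrN => h3 h4.
have := normr_ge0 (f c); have := normr_ge0 (f d) => h5 h6.
rewrite ler_norml; apply/andP; split; lra.
Qed.

Lemma constant_sign g T : continuous g -> (forall t, T <= t -> g t != 0) ->
  (forall t, T <= t -> 0 < g t) \/ (forall t, T <= t -> g t < 0).
Proof.
move=> gc g0; have := g0 T (lexx T); rewrite neq_lt => /orP[gT|gT];
  [right|left];
  move=> t Tt; rewrite ltNge; apply/negP => gt.
- have [|c [/andP[c1 _] cE]] := @continuous_IVT R g T t 0 gc Tt.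
    by left; rewrite ltW.
  by move: (g0 c c1); rewrite cE eqxx.
- have [|c [/andP[c1 _] cE]] := @continuous_IVT R g T t 0 gc Tt.
    by right; rewrite gt ltW.
  by move: (g0 c c1); rewrite cE eqxx.
Qed.

Definition norm_diverges g := forall M, exists T,
  forall t, T <= t \/ t <= - T -> M < `|g t|.

(** Tending to plus infinity at both ends, [g] would take a common value [c] far to the right and
    far to the left, and [f c] would be both at least 1 and at most -1. *)
Lemma not_two_sided f g T : continuous g -> diverges (f \o g) ->
  norm_diverges g ->
  (forall t, T <= t -> 0 < g t) -> (forall t, t <= - T -> 0 < g t) -> False.
Proof.
move=> gc dh dg gR gL; have [T1 T1P] := dh 1.
pose S := Num.max T T1; have [ST ST1] : T <= S /\ T1 <= S by split;
  rewrite le_max lexx ?orbT.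
pose c := Num.max (g S) (g (- S)).
have [c1 c2] : g S <= c /\ g (- S) <= c by split; rewrite le_max lexx ?orbT.
have [T2 T2P] := dg c.
pose U := Num.max S T2; have [US UT2] : S <= U /\ T2 <= U by split;
  rewrite le_max lexx ?orbT.
have cR : c <= g U.
  by have := T2P U (or_introl UT2);
    rewrite gtr0_norm ?gR ?(le_trans ST)// => /ltW.
have cL : c <= g (- U).
  have := T2P (- U); rewrite gtr0_norm ?gL ?lerN2 ?(le_trans ST)// => h.
  by apply/ltW/h; right.
have [|s1 [/andP[s11 _] s1E]] := @continuous_IVT R g S U c gc US.
  by left; rewrite c1.
have [||s2 [/andP[_ s22] s2E]] := @continuous_IVT R g (- U) (- S) c gc.
- by rewrite lerN2.
- by right; rewrite c2.
have := (T1P s1).1 (le_trans ST1 s11); rewrite /= s1E.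
have : s2 <= - T1 by apply: (le_trans s22); rewrite lerN2.
by move=> /(T1P s2).2; rewrite /= s2E; lra.
Qed.

Lemma signed_diverges g T : norm_diverges g ->
  (forall t, T <= t -> 0 < g t) -> (forall t, t <= - T -> g t < 0) ->
    diverges g.
Proof.
move=> dg gR gL M; have [T' T'P] := dg M.
exists (Num.max T T') => t; rewrite ge_max; split=> [/andP[t1 t2]|].
  by have := T'P t (or_introl t2); rewrite gtr0_norm ?gR// => /ltW.
rewrite lerNr ge_max !(lerNr _ t) => /andP[t1 t2].
by have := T'P t (or_intror t2); rewrite ltr0_norm ?gL// => /ltW; rewrite lerNr.
Qed.

(** As [f] is bounded on bounded sets, the absolute value of [g] tends to infinity. By the
    intermediate value property the sign of [g] is constant near each end, and the two signs differ
    by [not_two_sided]. *)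
Lemma orientation f g : continuous f -> continuous g ->
  diverges (f \o g) -> diverges g \/ diverges (fun t => - g t).
Proof.
move=> fc gc dh.
have dg : norm_diverges g.
  move=> M; have [B BP] := continuous_bounded M fc; have [T TP] := dh (B + 1).
  exists T => t tT; rewrite ltNge; apply/negP => /BP.
  have := ler_norm (f (g t)); have := ler_norm (- f (g t)); rewrite normrN.
  by case: tT => tT; [have := (TP t).1 tT|have := (TP t).2 tT]; rewrite /=; lra.
have dNg : norm_diverges (fun t => - g t).
  by move=> M; have [T TP] := dg M; exists T => t /TP; rewrite normrN.
have gNc : continuous (fun t => - g t) by move=> t; apply: cvgN; exact: gc.
have ogc : continuous (fun t => g (- t)).
  by move=> t; apply: continuous_comp; [exact: opp_continuous|exact: gc].
have dNh : diverges ((fun t => f (- t)) \o (fun t => - g t)).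
  by move=> M; have [T TP] := dh M; exists T => t; rewrite /= opprK; exact: TP.
have [T TP] := dg 0.
have rE (S : R -> Prop) : (forall t, T <= t -> S (- t)) -> forall t,
  t <= - T -> S t.
  by move=> H t tT; rewrite -[t]opprK; apply: H; rewrite lerNr.
have [|gR|gR] := @constant_sign g T gc.
- by move=> t Tt; rewrite -normr_gt0 TP//; left.
- have [|/(rE (fun t => 0 < g t)) gL|/(rE (fun t => g t < 0)) gL] :=
    @constant_sign _ T ogc.
  + by move=> t Tt; rewrite -normr_gt0 TP//; right; rewrite lerN2.
  + by case: (not_two_sided gc dh dg gR gL).
  + by left; exact: signed_diverges dg gR gL.
- have [|/(rE (fun t => 0 < g t)) gL|/(rE (fun t => g t < 0)) gL] :=
    @constant_sign _ T ogc.
  + by move=> t Tt; rewrite -normr_gt0 TP//; right; rewrite lerN2.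
  + right; apply: (signed_diverges dNg (T := T)) => t tT.
      by rewrite oppr_gt0 gR.
    by rewrite oppr_lt0 gL.
  + case: (not_two_sided gNc dNh dNg (T := T)) => t tT.
      by rewrite oppr_gt0 gR.
    by rewrite oppr_gt0 gL.
Qed.

End Divergence.

(** * Increasing enumeration of the values of a divergent sequence *)

Section Enumeration.
Variable R : realType.
Implicit Types (e : int -> R) (P : int -> bool) (f g : R -> R) (t : R).

Lemma next_value (x : int -> R) a : diverges x ->
  exists n, a < x n /\ forall m, ~ a < x m < x n.
Proof.
move=> dx; have [N1 N1P] := dx (`|a| + 1).
have aa := ler_norm a; have aN := ler_norm (- a); rewrite normrN in aN.
have xN1 : a < x N1 by have := (N1P N1).1 (lexx _); lra.
have [N2 N2P] := dx `|x N1|.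
(* Indices below [-K] give values under [a], those above [K] values not below [x N1]; so the least
   value exceeding [a] is found between [-K] and [K]. *)
pose K := (`|N1| + `|N2|)%N; pose y (k : 'I_(K + K).+1) := x (k%:Z - K%:Z).
have iP : (`|(N1 + K%:Z)%R|%N < (K + K).+1)%N by lia.
have yi : y (Ordinal iP) = x N1 by congr x => /=; lia.
have a0 : a < y (Ordinal iP) by rewrite yi.
case: (@arg_minP _ _ _ (Ordinal iP) (fun k => a < y k) y a0) => k ak kP.
exists (k%:Z - K%:Z); split=> // m /andP[am mk].
have [mK|mK] := leP m (- K%:Z - 1).
  have : m <= - N1 by lia.
  by move=> /(N1P m).2; lra.
have [Km|Km] := leP (K%:Z + 1) m.
  have : N2 <= m by lia.
  move=> /(N2P m).1; have := kP _ a0; rewrite yi => /(lt_le_trans mk).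
  by have := ler_norm (x N1); lra.
have jP : (`|(m + K%:Z)%R|%N < (K + K).+1)%N by lia.
have yj : y (Ordinal jP) = x m by congr x => /=; lia.
by have := kP (Ordinal jP); rewrite yj => /(_ am); rewrite leNgt mk.
Qed.

Lemma diverges_opp (x : int -> R) : diverges x -> diverges (fun n => - x (- n)).
Proof.
move=> dx M; have [N NP] := dx M; exists N => n; split=> Nn.
  by rewrite lerNr; apply: (NP _).2; lia.
by rewrite lerN2; apply: (NP _).1; lia.
Qed.

Lemma previous_value (x : int -> R) a : diverges x ->
  exists n, x n < a /\ forall m, ~ x n < x m < a.
Proof.
move=> /diverges_opp dx; have [n [an nP]] := next_value (- a) dx.
exists (- n); split; first by rewrite -ltrN2.
by move=> m; have := nP (- m); rewrite !opprK !ltrN2 andbC.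
Qed.

Lemma injective_values_unbounded (x : int -> R) (y : nat -> R) M :
  diverges x -> injective y -> (forall n, exists m, y n = x m) ->
  exists n, M < `|y n|.
Proof.
move=> dx yI /choice[k kP]; apply/not_existsP => nM.
have [N NP] := dx (M + 1); pose K := `|N|%N.
have M0 : 0 <= M.
  by have := nM 0%N; have := normr_ge0 (y 0%N); case: ltP => //; lra.
have kK n : - K%:Z < k n < K%:Z.
  have := nM n; rewrite kP => /negP; rewrite -leNgt ler_norml => /andP[h1 h2].
  apply/andP; split; rewrite ltNge; apply/negP => h.
    have : k n <= - N by lia.
    by move=> /(NP _).2; lra.
  have : N <= k n by lia.
  by move=> /(NP _).1; lra.
have hP (n : 'I_(K + K).+1) : (`|(k n + K%:Z)%R|%N < (K + K))%N.
  by have := kK n; lia.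
pose h n := Ordinal (hP n).
have hI : injective h.
  move=> n1 n2 [] E; apply/val_inj/yI; rewrite /= !kP; congr x.
  by have := kK n1; have := kK n2; lia.
by have := leq_card h hI; rewrite !card_ord ltnn.
Qed.

(** As [x] may repeat values and go back and forth, the grid starts at [x 0] and jumps to the next
    or previous value. It is unbounded on both sides because distinct values of [x] escape every
    bounded set. *)
Lemma enumeration (x : int -> R) : diverges x -> exists e, [/\ grid e,
  (forall i, exists n, e i = x n) & forall i n, ~ e i < x n < e (i + 1)].
Proof.
move=> dx.
have /choice[nx nxP] := fun a => next_value a dx.
have /choice[pv pvP] := fun a => previous_value a dx.
pose e (i : int) := match i with
  | Posz n => iter n (x \o nx) (x 0)
  | Negz n => iter n.+1 (x \o pv) (x 0) end.
have eE i : (e i < e (i + 1)) /\ forall n, ~ e i < x n < e (i + 1).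
  case: i => n.
    have -> : n%:Z + 1 = n.+1%:Z by lia.
    exact: nxP.
  case: n => [|n]; first exact: pvP.
  have -> : Negz n.+1 + 1 = Negz n by lia.
  exact: pvP.
have ex i : exists n, e i = x n.
  case: i => [[|n]|n]; first by exists 0.
    by exists (nx (iter n (x \o nx) (x 0))).
  by exists (pv (iter n (x \o pv) (x 0))).
have mono i (k : nat) : e i < e (i + k.+1%:Z).
  elim: k => [|k IH]; first exact: (eE _).1.
  have -> : i + k.+2%:Z = i + k.+1%:Z + 1 by lia.
  exact: lt_trans IH (eE _).1.
have mono' i j : i < j -> e i < e j.
  move=> ij; have -> : j = i + (`|j - i|%N.-1.+1)%:Z by lia.
  exact: mono.
have inj i j : e i = e j -> i = j.
  by move=> E; have [/mono'|/mono'|//] := ltgtP i j; rewrite E ltxx.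
exists e; split=> //; last by move=> i; exact: (eE i).2.
split=> [i|t]; first exact: (eE i).1.
have [j tj] : exists j, t < e j.
  have [||n b] := @injective_values_unbounded x (fun n =>
    e n%:Z) (`|t| + `|e 0|) dx.
  - by move=> n1 n2 /inj; lia.
  - by move=> n; exact: ex.
  exists n%:Z; have := ler_norm t.
  have : e 0 <= e n%:Z by case: n {b} => // n; apply/ltW/mono'; lia.
  have := ler_norm (- e 0); have := normr_ge0 t; have := normr_ge0 (e 0).
  by move: b; rewrite /= ltr_normr normrN => /orP[]; lra.
have [l lt] : exists l, e l <= t.
  have [||n b] := @injective_values_unbounded x (fun n =>
    e (- n%:Z)) (`|t| + `|e 0|) dx.
  - by move=> n1 n2 /inj; lia.
  - by move=> n; exact: ex.
  exists (- n%:Z); have := ler_norm (- t); rewrite normrN.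
  have : e (- n%:Z) <= e 0 by case: n {b} => [|n]; rewrite ?oppr0//;
    apply/ltW/mono'; lia.
  have := ler_norm (e 0); have := normr_ge0 t; have := normr_ge0 (e 0).
  by move: b; rewrite /= ltr_normr => /orP[]; lra.
have : t < e (l + (`|j - l|%N)%:Z).
  apply: lt_le_trans tj _; have [jl|jl] := leP j l.
    have [->|ne] := eqVneq j l; first by rewrite subrr addr0.
    by apply/ltW/mono'; lia.
  by have -> : l + (`|j - l|%N)%:Z = j by lia.
elim: `|j - l|%N => [|k IH tk]; first by rewrite addr0 ltNge lt.
have [/IH//|h] := ltP t (e (l + k%:Z)).
exists (l + k%:Z); rewrite h.
by have <- : l + k.+1%:Z = l + k%:Z + 1 by lia.
Qed.

End Enumeration.

(** * Sets to which a set with isolated marks reduces *)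

Definition sparse (P : int -> bool) := forall i : int, P i -> ~~ P (i + 1).

Section Convexity.
Variable R : realType.
Implicit Types (e : int -> R) (P : int -> bool) (f g : R -> R) (t : R).

(** The grid of [C] consists of the values of [g] at grid points. Between two consecutive such
    values [g] passes inside a single source letter, so [C] is constant on each open interval.
    Isolation of the marks then forces each grid point to disagree with the interval to its
    right. *)
Lemma reduced_wset d P g (C : set R) : grid d -> sparse P ->
  reduces g (wset d P) C -> diverges (g \o d) ->
  exists e c, [/\ grid e, sparse c & C = wset e c].
Proof.
move=> gd isoP gr dx; have gP := reducesE gr; have gc := gr.1.
have [e [ge ex eN]] := enumeration dx.
(* [nu i] holds a source index and two points of its closed interval between which [g] passes from
   [e i] to [e (i + 1)]. *)
have /choice[nu nuP] : forall i, exists nu : int * (R * R),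
    [/\ d nu.1 <= nu.2.1 /\ nu.2.2 <= d (nu.1 + 1), nu.2.1 < nu.2.2,
        g nu.2.1 = e i, g nu.2.2 = e (i + 1) &
        forall s, e i < s < e (i + 1) -> C s <-> ~~ P nu.1].
  move=> i; have [N NP] := dx (`|e i| + `|e (i + 1)|).
  have h1 := normr_ge0 (e i); have h2 := normr_ge0 (e (i + 1)).
  have h3 := ler_norm (- e i); have h4 := ler_norm (e (i + 1)).
  rewrite normrN in h3.
  have dd : d (- `|N|%N%:Z) <= d `|N|%N%:Z by apply: grid_le => //; lia.
  have gl : g (d (- `|N|%N%:Z)) <= e i.
    have : - `|N|%N%:Z <= - N by lia.
    by move=> /(NP _).2 /=; lra.
  have gr' : e (i + 1) <= g (d `|N|%N%:Z).
    have : N <= `|N|%N%:Z by lia.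
    by move=> /(NP _).1 /=; lra.
  have [u [v [uv gu gv uvP]]] := crossing gc dd gl (ge.1 i) gr'.
  have [n /andP[nu un]] := gd.2 u.
  have vn : v <= d (n + 1).
    rewrite leNgt; apply/negP => nv; apply: (eN i (n + 1)).
    by apply: uvP; rewrite un.
  exists (n, (u, v)); split=> //= s /andP[s1 s2].
  have [|w [/andP[w1 w2] wE]] := @continuous_IVT R g u v s gc (ltW uv).
    by left; rewrite gu gv !ltW.
  have uw : u < w by rewrite lt_neqAle w1 andbT; apply/eqP => E;
    rewrite -wE -E gu ltxx in s1.
  have wv : w < v by rewrite lt_neqAle w2 andbT; apply/eqP => E;
    rewrite -wE E gv ltxx in s2.
  by rewrite -wE -gP; apply: wset_itv => //;
    rewrite (le_lt_trans nu uw) (lt_le_trans wv).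
pose c i := `[< C (e i) >]; pose o i := ~~ P (nu i).1.
(* A grid point of [C] and the intervals on its two sides cannot all agree: [C] would be constant
   near [e i], hence the source set near a grid point that [g] sends to [e i]. *)
have boundary i (Q : Prop) : (C (e i) <-> Q) -> (o (i - 1) <-> Q) ->
  (o i <-> Q) -> False.
  move=> cQ opQ oQ; have [m em] := ex i.
  apply: (@grid_point_boundary R d P m Q gd).
  have eI : g (d m) \in `]e (i - 1), e (i + 1)[.
    by rewrite in_itv/= -[g _]em !grid_lt//; lia.
  have fN := gc (d m) _ (near_in_itvoo eI).
  apply: (@filterS _ (nbhs (d m)) _ _ _ _ fN) => s.
  rewrite /preimage/= in_itv/= => /andP[s1 s2]; rewrite gP.
  have [_ _ _ _ h1] := nuP (i - 1); have [_ _ _ _ h2] := nuP i.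
  rewrite subrK in h1.
  have [lt|lt|->//] := ltgtP (g s) (e i).
    by rewrite h1 ?s1.
  by rewrite h2 ?s2 ?lt.
(* An interior end point of the passage shares the membership of its interval. If the end point is
   the next grid point, it is a mark, so by isolation the letter before it is not. *)
have F2 i : c i -> o (i - 1).
  move=> /asboolP; have [[nu1 nu2] nu3 _ nu4 _] := nuP (i - 1).
  rewrite subrK in nu4; rewrite -nu4 -gP => Wv.
  have := nu2; rewrite le_eqVlt => /predU1P[vE|lt].
    move: Wv; rewrite vE => /(wset_point _ _ gd) Pn.
    by apply/negP => /isoP; rewrite Pn.
  have : d (nu (i - 1)).1 < (nu (i - 1)).2.2 < d ((nu (i - 1)).1 + 1).
    by rewrite lt (le_lt_trans nu1 nu3).
  by move: Wv => /[swap] /(wset_itv P gd) ->.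
have F3 i : c i -> ~~ o i.
  move=> ci; apply/negP => oi; apply: (@boundary i True); split=> // _.
    by apply/asboolP.
  exact: F2.
(* Otherwise [o (i - 1)], [o (i + 1)] and not [c (i + 1)], and the letter [n] passing over the
   interval is a mark. So [g] starts at [d n] inside [C] and has to reach [e i] without meeting [C]
   at any other point. *)
have F4 i : ~~ c i -> o i.
  move=> nci; have [//|noi] := boolP (o i); exfalso.
  have oi1 : o (i - 1).
    have [//|noi1] := boolP (o (i - 1)); exfalso; apply: (@boundary i False);
      split=> //.
    - by move=> Ci; move/negP: nci; apply; apply/asboolP.
    - by rewrite (negbTE noi1).
    - by rewrite (negbTE noi).
  have nci1 : ~~ c (i + 1) by apply/negP => /F2; rewrite addrK (negbTE noi).
  have oi2 : o (i + 1).
    have [//|noi2] := boolP (o (i + 1)); exfalso;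
      apply: (@boundary (i + 1) False); split=> //.
    - by move=> Ci; move/negP: nci1; apply; apply/asboolP.
    - by rewrite addrK (negbTE noi).
    - by rewrite (negbTE noi2).
  have [[nu1 nu2] nu3 gu gv nuC] := nuP i.
  set n := (nu i).1 in nu1 nu2 nuC; set u := (nu i).2.1 in nu1 nu3 gu.
  have Pn : P n by move/negPn: noi.
  have nWu : ~ wset d P u.
    by rewrite gP gu => /asboolP; rewrite -/(c i) (negbTE nci).
  have ltu : d n < u.
    rewrite lt_neqAle nu1 andbT; apply/eqP => E; apply: nWu.
    by rewrite -E; apply/wset_point.
  have ltu2 : u < d (n + 1) by exact: lt_le_trans nu3 nu2.
  have Cn : C (g (d n)) by rewrite -gP; apply/wset_point.
  have key s : C s -> g (d n) <= s < g u \/ g u < s <= g (d n) ->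
    s != g (d n) -> False.
    move=> Cs h ne; have [|w [/andP[w1 w2] wE]] :=
      @continuous_IVT R g (d n) u s gc nu1.
      by case: h => /andP[h1 h2]; [left|right]; rewrite ?h1 ?h2 ?ltW.
    have nw : d n < w.
      by rewrite lt_neqAle w1 andbT; apply: contraNneq ne => ->; rewrite wE.
    have : d n < w < d (n + 1) by rewrite nw (le_lt_trans w2).
    by move=> /(wset_itv P gd); rewrite gP wE Pn => /iffLR /(_ Cs).
  (* If [g (d n)] is outside the closed interval from [e i] to [e (i + 1)], the path crosses part of
     an adjacent interval contained in [C]; and that closed interval itself is disjoint from [C]. *)
  have [lt|] := ltP (g (d n)) (e i).
    have [_ _ _ _ h] := nuP (i - 1); rewrite subrK in h.
    have Hd := ge.1 (i - 1); rewrite subrK in Hd.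
    pose s := (Num.max (g (d n)) (e (i - 1)) + e i) / 2.
    have [s1 s2 s3] : [/\ g (d n) < s, e (i - 1) < s & s < e i].
      by rewrite /s; case: (leP (g (d n)) (e (i - 1))) => ?; split; lra.
    apply: (key s).
    - by rewrite h ?s2.
    - by left; rewrite gu s3 ltW.
    - by rewrite gt_eqF.
  rewrite le_eqVlt => /predU1P[E|lt].
    by move/negP: nci; apply; apply/asboolP; rewrite E.
  have [lt2|] := ltP (g (d n)) (e (i + 1)).
    have := nuC (g (d n)); rewrite lt lt2 => /(_ isT).
    by rewrite Pn => /iffLR /(_ Cn).
  rewrite le_eqVlt => /predU1P[E|lt2].
    by move/negP: nci1; apply; apply/asboolP; rewrite E.
  have [_ _ _ _ h] := nuP (i + 1).
  have Hd := ge.1 (i + 1); have Hd' := ge.1 i.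
  pose s := (Num.min (g (d n)) (e (i + 1 + 1)) + e (i + 1)) / 2.
  have [s1 s2 s3] : [/\ s < g (d n), s < e (i + 1 + 1) & e (i + 1) < s].
    by rewrite /s; case: (leP (g (d n)) (e (i + 1 + 1))) => ?; split; lra.
  apply: (key s).
  - by rewrite h ?s2 ?s3.
  - by right; rewrite gu (ltW s1) andbT (lt_trans Hd').
  - by rewrite lt_eqF.
exists e, c; split=> //.
  by move=> i ci; apply/negP => /F2; rewrite addrK (negbTE (F3 i ci)).
apply/seteqP; suff H s : C s <-> wset e c s by split=> s /H.
have [[i ->]|[i sI]] := grid_cases s ge.
  by rewrite wset_point//; split=> /asboolP.
have [_ _ _ _ h] := nuP i; rewrite (wset_itv _ ge sI) h//.
by split=> h1; [apply/negP => /F3; rewrite /o h1|exact: F4].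
Qed.

End Convexity.

(** * Marks and their distances *)

Definition spaced (p : int -> int) := forall j : int, p j + 2 <= p (j + 1).

Definition mark (p : int -> int) (i : int) : bool := `[< exists j, i = p j >].

Definition gap_le (p q : int -> int) :=
  exists k : int, forall j : int, q (j + k + 1) - q (j + k) <= p (j + 1) - p j.

Lemma int_shift (s : int -> int) :
  (forall j : int, s (j + 1) = s j + 1) -> forall j : int, s j = j + s 0.
Proof.
move=> sS; case=> n.
  elim: n => [|n IH]; first by rewrite add0r.
  have -> : n.+1%:Z = n%:Z + 1 by lia.
  by rewrite sS IH; lia.
elim: n => [|n IH].
  by have := sS (Negz 0); rewrite (_ : Negz 0 + 1 = 0)//; lia.
have := sS (Negz n.+1); rewrite (_ : Negz n.+1 + 1 = Negz n); last by lia.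
by rewrite IH; lia.
Qed.

Lemma spaced_lower p (j : int) (n : nat) : spaced p ->
  p j + n%:Z <= p (j + n%:Z).
Proof.
move=> sp; elim: n => [|n IH]; first by rewrite !addr0.
have -> : j + n.+1%:Z = j + n%:Z + 1 by lia.
by have := sp (j + n%:Z); lia.
Qed.

Lemma spaced_lt p (i j : int) : spaced p -> i < j -> p i < p j.
Proof.
move=> sp ij; have := spaced_lower i `|j - i|%N sp.
by have -> : i + (`|j - i|%N)%:Z = j; lia.
Qed.

Lemma spaced_le p (i j : int) : spaced p -> i <= j -> p i <= p j.
Proof.
move=> sp; rewrite le_eqVlt => /predU1P[->//|ij]; exact/ltW/spaced_lt.
Qed.

Lemma spaced_cover p (i : int) : spaced p -> exists j : int,
  p j <= i < p (j + 1).
Proof.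
move=> sp; pose n := (`|p 0|%N + `|i|%N)%N; pose l : int := - n%:Z.
have low : p l <= i.
  by have := spaced_lower l n sp; rewrite addNr; move: (p l); rewrite /n;
    move: (p 0) => ?; lia.
have : i < p (l + (n + n.+1)%N%:Z).
  have -> : l + (n + n.+1)%N%:Z = 0 + n.+1%:Z by rewrite /l; lia.
  have := spaced_lower 0 n.+1 sp; move: (p (0 + _)); rewrite /n;
    move: (p 0) => ?; lia.
elim: (n + n.+1)%N => [|k IH h]; first by rewrite addr0; lia.
have [/IH//|h2] := ltP i (p (l + k%:Z)).
exists (l + k%:Z); rewrite h2/=.
by have <- : l + k.+1%:Z = l + k%:Z + 1 by lia.
Qed.

Lemma mark_value p j : mark p (p j).
Proof. by apply/asboolP; exists j. Qed.

Lemma mark_between p (i j : int) : spaced p -> p j < i < p (j + 1) ->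
  ~~ mark p i.
Proof.
move=> sp ij; apply/negP => /asboolP[k ik]; move: ij;
  rewrite ik => /andP[h1 h2].
have h3 : j < k by rewrite ltNge; apply/negP => /(spaced_le sp); lia.
have h4 : k < j + 1 by rewrite ltNge; apply/negP => /(spaced_le sp); lia.
lia.
Qed.

Lemma mark_sparse p : spaced p -> sparse (mark p).
Proof.
move=> sp i /asboolP[j ->]; apply: (@mark_between _ _ j) => //.
by have := sp j; lia.
Qed.

(** From a mark the walk must step forward: staying would read a mark for an unmarked letter, and
    stepping back needs an adjacent second mark. Afterwards, reading unmarked letters, it cannot
    step back onto the mark, and it uncovers at most one new letter at a time. *)
Lemma walk_between p Q phi (j : int) (n : nat) : spaced p -> sparse Q ->
  walk (mark p) Q phi -> (0 < n)%N -> p j + n%:Z <= p (j + 1) ->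
  [/\ phi (p j) + 1 <= phi (p j + n%:Z), phi (p j + n%:Z) <= phi (p j) + n%:Z &
    forall q : int, phi (p j) < q < phi (p j + n%:Z) -> ~~ Q q].
Proof.
move=> sp iQ wphi; have Qj : Q (phi (p j)) by rewrite -(wphi _).1 mark_value.
have nQ q : Q q -> Q (q - 1) = false.
  by move=> Qq; apply/negP => /iQ; rewrite subrK Qq.
elim: n => [//|n IH] _ nle; have [n0|n0] := posnP n.
  rewrite {}n0 in nle *; have [_] := wphi (p j).
  case=> [->|E|[_]]; last by rewrite mark_value nQ.
    by split; [lia|lia|move=> q; lia].
  have : ~~ mark p (p j + 1) by apply: (@mark_between _ _ j) => //;
    have := sp j; lia.
  by rewrite (wphi _).1 E Qj.
have [|h1 h2 h3] := IH n0; first by lia.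
have nm : mark p (p j + n%:Z) = false.
  by apply/negbTE/(@mark_between _ _ j) => //; lia.
have := wphi (p j + n%:Z); rewrite nm => -[/esym nQn].
have -> : p j + n%:Z + 1 = p j + n.+1%:Z by lia.
case=> [->|->|[E1 E2]].
- split; [lia|lia|move=> q /andP[q1 q2]].
  have [->|ne] := eqVneq q (phi (p j + n%:Z)); first by rewrite nQn.
  by apply: h3; lia.
- by split; [lia|lia|].
- have ne : phi (p j + n%:Z) - 1 != phi (p j).
    by apply/eqP => E; move: E2; rewrite E Qj.
  rewrite E1; split; [lia|lia|move=> q q1]; apply: h3; lia.
Qed.

Lemma walk_rigid p Q phi : spaced p -> sparse Q -> walk (mark p) Q phi ->
  forall j : int, [/\ phi (p j) < phi (p (j + 1)),
    phi (p (j + 1)) - phi (p j) <= p (j + 1) - p j,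
    forall q : int, phi (p j) < q < phi (p (j + 1)) -> ~~ Q q &
    forall i : int, p j <= i <= p (j + 1) ->
      phi (p j) <= phi i <= phi (p (j + 1))].
Proof.
move=> sp iQ wphi j; have spj := sp j.
have bet (i : int) : p j < i <= p (j + 1) -> [/\ phi (p j) + 1 <= phi i,
    phi i <= phi (p j) + (i - p j) &
    forall q : int, phi (p j) < q < phi i -> ~~ Q q].
  move=> ij; have := @walk_between p Q phi j `|i - p j|%N sp iQ wphi.
  have -> : (`|i - p j|%N)%:Z = i - p j by lia.
  have -> : p j + (i - p j) = i by lia.
  by apply; lia.
have [|h1 h2 h3] := bet (p (j + 1)); first by lia.
split=> //; [lia|lia|move=> i /andP[i1 i2]].
have [->|ne] := eqVneq i (p j); first by lia.
have [|h4 h5 h6] := bet i; first by lia.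
apply/andP; split; first by lia.
(* Otherwise the image of the next mark would lie strictly inside a stretch free of marks. *)
rewrite leNgt; apply/negP => lt.
have h7 : phi (p j) < phi (p (j + 1)) < phi i by lia.
by move: (h6 _ h7); rewrite -(wphi _).1 mark_value.
Qed.

(** Consecutive marks go to consecutive marks, as no mark lies between their images; so the induced
    map of indices is a shift. *)
Lemma walk_marks p q phi : spaced p -> spaced q -> walk (mark p) (mark q) phi ->
  exists k : int, forall j : int, phi (p j) = q (j + k).
Proof.
move=> sp sq wphi; have rig := walk_rigid sp (mark_sparse sq) wphi.
have /choice[s sE] : forall j, exists k, phi (p j) = q k.
  by move=> j; apply/asboolP; rewrite -/(mark q _) -(wphi _).1 mark_value.
exists (s 0) => j; rewrite sE; congr q; apply: int_shift => {}j.
have [h1 _ h2 _] := rig j; rewrite !sE in h1 h2.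
have h3 : s j < s (j + 1).
  by rewrite ltNge; apply/negP => /(spaced_le sq); rewrite leNgt h1.
have [//|h4] : s (j + 1) = s j + 1 \/ s j + 1 < s (j + 1) by lia.
have := h2 (q (s j + 1)); rewrite mark_value !spaced_lt//; last by lia.
by move=> /(_ isT).
Qed.

Lemma walk_gap_le p q phi : spaced p -> spaced q ->
  walk (mark p) (mark q) phi -> gap_le p q.
Proof.
move=> sp sq wphi; have [k kE] := walk_marks sp sq wphi; exists k => j.
have [_ + _ _] := walk_rigid sp (mark_sparse sq) wphi j.
by rewrite !kE; have -> : j + 1 + k = j + k + 1 by lia.
Qed.

Lemma gap_le_walk p q : spaced p -> spaced q -> gap_le p q ->
  exists phi, walk (mark p) (mark q) phi.
Proof.
move=> sp sq [k kP].
have /choice[idx idxP] := fun i => spaced_cover i sp.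
(* After a mark the walk waits at the first unmarked letter and sets off at the last moment that
   lets it reach the next mark in time by unit steps. *)
pose phi i := let j := idx i in if i == p j then q (j + k)
  else Num.max (q (j + k) + 1) (q (j + k + 1) - (p (j + 1) - i)).
have idxE (i j : int) : p j <= i < p (j + 1) -> idx i = j.
  move=> /andP[h1 h2]; have /andP[h3 h4] := idxP i.
  have h5 : j < idx i + 1 by rewrite ltNge; apply/negP => /(spaced_le sp); lia.
  have h6 : idx i < j + 1 by rewrite ltNge; apply/negP => /(spaced_le sp); lia.
  lia.
have phip j : phi (p j) = q (j + k).
  by rewrite /phi (@idxE _ j) ?eqxx//; have := sp j; lia.
have phib (i j : int) : p j < i <= p (j + 1) ->
    phi i = Num.max (q (j + k) + 1) (q (j + k + 1) - (p (j + 1) - i)).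
  move=> ij; have [->|ne] := eqVneq i (p (j + 1)).
    rewrite phip (_ : j + 1 + k = j + k + 1); last by lia.
    by have := sq (j + k); lia.
  by rewrite /phi (@idxE _ j); [case: eqP; lia|lia].
exists phi => i; have [j jP] := spaced_cover i sp.
have spj := sp j; have sqj := sq (j + k); have kj := kP j.
have [iE|ne] := eqVneq i (p j).
  split; first by rewrite iE phip !mark_value.
  have -> : phi (i + 1) = Num.max (q (j + k) + 1) (q (j + k + 1) - (p (j + 1) - (i + 1))).
    by apply: phib; lia.
  by rewrite iE phip; constructor 1; lia.
have iE : phi i = Num.max (q (j + k) + 1) (q (j + k + 1) - (p (j + 1) - i)).
  by apply: phib; lia.
have iE1 : phi (i + 1) = Num.max (q (j + k) + 1) (q (j + k + 1) - (p (j + 1) - (i + 1))).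
  by apply: phib; lia.
split.
  rewrite (negbTE (@mark_between p i j sp _)); last by lia.
  by rewrite (negbTE (@mark_between q _ (j + k) sq _))//; lia.
have [E|E] : phi (i + 1) = phi i + 1 \/ phi (i + 1) = phi i by lia.
  by constructor 1.
by constructor 2.
Qed.

(** * Coded sets on the integer grid and their convexity *)

Section LineSets.
Variable R : realType.
Implicit Types (e : int -> R) (P : int -> bool) (f g : R -> R) (t : R).

Definition zgrid (i : int) : R := i%:~R.

Definition line_set (p : int -> int) : set R := wset zgrid (mark p).

Lemma zgridP : grid zgrid.
Proof.
split=> [i|t]; first by rewrite ltr_int; lia.
by exists (Num.floor t); apply: floor_itv; exact: num_real.
Qed.

Lemma le_zgrid_ceil t : t <= zgrid `|Num.ceil t|%N%:Z.
Proof. by apply: le_trans (ceil_ge t) _; rewrite ler_int;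
  case: (Num.ceil t). Qed.

Lemma reduces_comp f g (A B C : set R) : reduces f A B -> reduces g B C ->
  reduces (g \o f) A C.
Proof.
move=> [fc ->] [gc ->]; split=> // t.
by apply: continuous_comp; [exact: fc|exact: gc].
Qed.

Lemma line_set_reduces p q : spaced p -> spaced q ->
  (exists f, reduces f (line_set p) (line_set q)) <-> gap_le p q.
Proof.
move=> sp sq; split=> [[f fr]|/(gap_le_walk sp sq)[phi wphi]].
  have [phi wphi _] := reduction_walk zgridP zgridP fr.
  exact: walk_gap_le wphi.
exact: walk_reduces zgridP zgridP wphi.
Qed.

(** Marks go to marks with a fixed shift, and the walk stays between the images of neighbouring
    marks, so it diverges; [h] stays within one grid step of it. *)
Lemma line_set_reduction_diverges p q h : spaced p -> spaced q ->
  reduces h (line_set p) (line_set q) -> diverges h.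
Proof.
move=> sp sq hr M.
have [phi wphi hE] := reduction_walk zgridP zgridP hr.
have [k kE] := walk_marks sp sq wphi.
have rig := walk_rigid sp (mark_sparse sq) wphi.
pose b : int := `|Num.ceil M|%N%:Z + 1.
have Mb : M <= zgrid (b - 1).
  by rewrite /b addrK; exact: le_zgrid_ceil.
have [J /andP[_ J2]] := spaced_cover b sq.
have [L /andP[L1 _]] := spaced_cover (- b) sq.
pose j : int := J + 1 - k; pose l : int := L - k.
have jb (i : int) : p j <= i -> b <= phi i.
  move=> ji; have [i' /andP[i1 i2]] := spaced_cover i sp.
  have ji' : j <= i'.
    rewrite leNgt; apply/negP => lt.
    have : p (i' + 1) <= p j by apply: spaced_le => //; lia.
    by lia.
  have [_ _ _ /(_ i)] := rig i'; rewrite i1 (ltW i2) !kE => /(_ isT)/andP[h1 _].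
  apply: le_trans h1; apply: le_trans (ltW J2) _; apply: spaced_le => //.
  by rewrite /j in ji'; lia.
have lb (i : int) : i <= p l -> phi i <= - b.
  move=> il; have [i' /andP[i1 i2]] := spaced_cover i sp.
  have [->|ne] := eqVneq i (p l).
    by rewrite kE /l subrK.
  have ji' : i' + 1 <= l.
    rewrite leNgt; apply/negP => lt.
    have : p l <= p i' by apply: spaced_le => //; lia.
    by lia.
  have [_ _ _ /(_ i)] := rig i'; rewrite i1 (ltW i2) !kE => /(_ isT)/andP[_ h1].
  apply: le_trans L1; apply: le_trans h1 _; apply: spaced_le => //.
  by rewrite /l in ji'; lia.
exists (zgrid (`|p j|%N + `|p l|%N + 1)%N%:Z) => t.
have [i /andP[i1 i2]] := zgridP.2 t.
have /andP[b1 b2] : zgrid (phi i - 1) <= h t <= zgrid (phi i + 1).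
  by apply: (reduction_bound zgridP zgridP hr (hE i)); rewrite i1 ltW.
split=> tT.
  apply: le_trans b1; apply: (le_trans Mb); rewrite ler_int.
  have := grid_lt_inv zgridP (le_lt_trans tT i2) => h1.
  by have := jb i; lia.
apply: (le_trans b2).
have : zgrid i <= zgrid (- (`|p j|%N + `|p l|%N + 1)%N%:Z).
  by rewrite /zgrid mulrNz; exact: le_trans i1 tT.
move=> /(grid_le_inv zgridP) h1.
have : phi i + 1 <= - (b - 1) by have := lb i; lia.
rewrite -(ler_int R) mulrNz => /le_trans; apply.
by rewrite lerN2.
Qed.

Lemma reduces_opp (A : set R) : reduces -%R A (-%R @^-1` A) /\
  reduces -%R (-%R @^-1` A) A.
Proof.
split; split; first exact: opp_continuous.
- by apply/seteqP; split=> t; rewrite /preimage/= opprK.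
- exact: opp_continuous.
- by [].
Qed.

(** By [reduced_wset], [C] is coded on some grid. Its marks are exactly the images of the marks of
    [p] under the walk given by [g], since nothing between two consecutive images is marked. *)
Lemma line_set_convex_oriented p q f g (C : set R) : spaced p -> spaced q ->
  reduces g (line_set p) C -> reduces f C (line_set q) -> diverges g ->
  exists r, [/\ spaced r, exists f', reduces f' C (line_set r) &
    exists f', reduces f' (line_set r) C].
Proof.
move=> sp sq gr fr dg.
have dx : diverges (g \o zgrid).
  move=> M; have [T TP] := dg M; exists `|Num.ceil T|%N%:Z => n.
  have Tc := le_zgrid_ceil T.
  split=> nT /=; first by apply: (TP _).1; apply: (le_trans Tc);
    rewrite ler_int.
  apply: (TP _).2; rewrite lerNr; apply: (le_trans Tc).
  by rewrite -mulrNz ler_int; lia.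
have [e [c [ge sc CE]]] := reduced_wset zgridP (mark_sparse sp) gr dx.
rewrite {}CE in gr fr *.
have [phi wphi _] := reduction_walk zgridP ge gr.
have rig := walk_rigid sp sc wphi.
pose r := phi \o p.
have cr j : c (r j) by rewrite /r/= -(wphi _).1 mark_value.
have sr : spaced r.
  move=> j; have [lt _ _ _] := rig j.
  have ne : phi (p (j + 1)) != phi (p j) + 1.
    by apply: contraTneq (cr (j + 1)) => /= E; rewrite /r/= E; apply/sc/cr.
  by rewrite /r /=; lia.
have cE i : c i = mark r i.
  apply/idP/asboolP => [ci|[j ->]]; last exact: cr.
  have [j /andP[j1 j2]] := spaced_cover i sr; exists j; apply/eqP.
  apply: contraTT ci => ne; have [_ _ nc _] := rig j.
  by apply: nc; move: ne j1 j2; rewrite /r /=; lia.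
exists r; split=> //.
(* Changing the grid preserves the Wadge degree: the identity on indices is a walk between equal
   words. *)
- apply: (walk_reduces (phi := id) ge zgridP).
  by move=> i; split=> //; constructor 1.
- apply: (walk_reduces (phi := id) zgridP ge).
  by move=> i; split=> //; constructor 1.
Qed.

(** If [g] exchanges the two ends of the line, [C] is replaced by its mirror image, which is
    equivalent to it. *)
Lemma line_set_convex p q f g (C : set R) : spaced p -> spaced q ->
  reduces g (line_set p) C -> reduces f C (line_set q) ->
  exists r, [/\ spaced r, exists f', reduces f' C (line_set r) &
    exists f', reduces f' (line_set r) C].
Proof.
move=> sp sq gr fr.
have := line_set_reduction_diverges sp sq (reduces_comp gr fr).
case/(orientation fr.1 gr.1) => dg;
  first exact: line_set_convex_oriented gr fr dg.
have [opp1 opp2] := reduces_opp C.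
have [r [sr [f1 f1r] [f2 f2r]]] :=
  line_set_convex_oriented sp sq (reduces_comp gr opp1) (reduces_comp opp2 fr) dg.
exists r; split=> //; first by exists (f1 \o -%R); exact: reduces_comp f1r.
by exists (-%R \o f2); exact: reduces_comp opp2.
Qed.

End LineSets.

(** * Subsets of the natural numbers *)

Lemma finite_nat_bounded (A : set nat) : finite_set A ->
  exists b, forall n, A n -> (n < b)%N.
Proof.
move=> /finite_seqP[s ->]; exists (\max_(i <- s) i).+1 => n /= ns.
by rewrite ltnS; exact: (@leq_bigmax_seq _ s xpredT id n ns).
Qed.

Lemma bounded_nat_finite (A : set nat) b : (forall n, A n -> (n < b)%N) ->
  finite_set A.
Proof. by move=> Ab; apply: (@sub_finite_set _ _ `I_b) => // n /Ab. Qed.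

Lemma infinite_nat_injP (A : set nat) :
  infinite_set A <-> exists2 f : nat -> nat, forall n, A (f n) & injective f.
Proof.
rewrite infiniteP; split=> [/pcard_leP/injfunPex[f fA fI]|[f fA fI]].
  by exists f => [n|m n]; [exact: fA|apply: fI; rewrite inE].
by apply/pcard_leP/injfunPex; exists f => [n _|m n _ _]; [exact: fA|exact: fI].
Qed.

Lemma infinite_split (A : set nat) : infinite_set A -> exists B,
  [/\ B `<=` A, infinite_set B & infinite_set (A `\` B)].
Proof.
move=> /infinite_nat_injP[f fA fI].
have even_odd i j : f i.*2 <> f j.*2.+1 by move=> /fI; lia.
exists (range (fun n => f n.*2)); split.
- by move=> _ [n _ <-]; exact: fA.
- apply/infinite_nat_injP; exists (fun n => f n.*2) => [n|i j /fI]; last by lia.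
  by exists n.
- apply/infinite_nat_injP; exists (fun n => f n.*2.+1) => [n|i j /fI];
  last by lia.
  by split; [exact: fA|move=> [m _ /even_odd]].
Qed.

(** * Distances that code a subset of the natural numbers *)

Definition level (n : nat) : nat := trunc_log 4 n.

(* On the negative half-line the distance is the smallest possible one, so that a
   shift to the left is harmless there. *)
Definition width (a : set nat) (j : int) : int :=
  if j is Posz n then (2 * level n + 2 + (level n \notin a))%N%:Z else 2.

(** The larger sequence has the smaller terms, because a reduction cannot stretch distances;
    accordingly membership in [a] lowers [width a]. *)
Definition seq_le (r s : int -> int) :=
  exists k : int, forall j : int, s (j + k) <= r j.

Lemma width_level a n (m : nat) : (4 ^ n <= m < 4 ^ n.+1)%N ->
  width a m%:Z = (2 * n + 2 + (n \notin a))%N%:Z.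
Proof. by move=> mn; rewrite /width/= /level (trunc_log_eq _ mn). Qed.

(** A width of higher level exceeds every width of lower level, whatever the sets, and 2 is the
    least width. So a drop to the right happens inside one block, whose length bounds the shift. *)
Lemma width_drop x y (i i' : int) : i <= i' -> width y i' < width x i ->
  let n := level `|i| in
  [/\ n \notin x, n \in y, level `|i'| = n & i' - i < (4 ^ n.+1)%N%:Z].
Proof.
case: i i' => m [] m' //=; last by case: (_ \notin y); lia.
move=> mm; have : (level m <= level m')%N by exact: leq_trunc_log.
have : (m' < 4 ^ (level m').+1)%N by exact: trunc_log_ltn.
have [<-|ne] := eqVneq (level m) (level m'); last first.
  by case: (_ \notin x) (_ \notin y) => [] [] /=; lia.
move=> h _; case: (level m \in x) (level m \in y) => [] [] //=; try lia.
by split=> //; lia.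
Qed.

Lemma sub_finP (a b : set nat) : sub_fin a b <->
  exists N, forall n, a n -> (N <= n)%N -> b n.
Proof.
split=> [/finite_nat_bounded[N NP]|[N NP]].
  exists N => n an Nn; apply: contrapT => bn.
  by have := NP n (conj an bn); lia.
apply: (@bounded_nat_finite _ N) => n [an bn]; rewrite ltnNge.
by apply/negP => /(NP n an).
Qed.

Lemma width_seq_le a b : seq_le (width a) (width b) <-> sub_fin a b.
Proof.
rewrite sub_finP; split=> [[k kP]|[N NP]].
  exists `|k|%N => n an kn; have kn4 : (`|k| < 4 ^ n)%N.
    exact: leq_ltn_trans kn (ltn_expl n _).
  (* From this index a shift by less than [4 ^ n] does not leave the block of [n]. *)
  have := kP (2 * 4 ^ n)%N%:Z.
  have -> : (2 * 4 ^ n)%N%:Z + k = (`|((2 * 4 ^ n)%N%:Z + k)%R|%N)%:Z by lia.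
  rewrite !(@width_level _ n) ?(mem_set an); try by rewrite expnS; lia.
  by case: (boolP (n \in b)) => [/set_mem//|_] /=; lia.
(* The blocks [n < N] are too short for a drop across a shift by [4 ^ N], and from [N] on every
   element of [a] is in [b]. *)
exists (- (4 ^ N)%N%:Z) => j; rewrite leNgt; apply/negP => lt.
have [|nb /set_mem na _] := width_drop _ lt; first by lia.
rewrite (_ : j - (j + _) = (4 ^ N)%N%:Z); last by lia.
rewrite ltz_nat ltn_exp2l// ltnS => /(NP _ na) /mem_set.
by rewrite (negbTE nb).
Qed.

Lemma subset_sub_fin (a b : set nat) : a `<=` b -> sub_fin a b.
Proof. by move=> /subsets_disjoint; rewrite /sub_fin setDE => ->;
  exact: finite_set0. Qed.

(* One half of [N] is put below the new set, the other half stays above it. *)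
Lemma fill_gap (X Y : set (set nat)) (N : set nat) :
  (forall x y, X x -> Y y -> sub_fin x y) -> infinite_set N ->
  (forall x, X x -> finite_set (N `&` x)) ->
  (forall y, Y y -> finite_set (N `\` y)) ->
  (exists x, X x /\ forall x', X x' -> sub_fin x' x) \/
  (exists y, Y y /\ forall y', Y y' -> sub_fin y y') ->
  exists c, forall x y, X x -> Y y -> strict sub_fin x c /\ strict sub_fin c y.
Proof.
move=> XY /infinite_split[M [MN Minf NMinf]] NX NY.
have fin2 (A B C : set nat) : finite_set B -> finite_set C ->
    A `<=` B `|` C -> finite_set A.
  by move=> fB fC /sub_finite_set; apply; rewrite finite_setU.
have fin3 (A B C D : set nat) : finite_set B -> finite_set C -> finite_set D ->
    A `<=` B `|` C `|` D -> finite_set A.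
  by move=> fB fC fD; apply: fin2 => //; rewrite finite_setU.
case=> [[x0 [Xx0 x0P]]|[y0 [Yy0 y0P]]].
  exists (x0 `|` M) => x y Xx Yy; split; split.
  - by apply: sub_fin_trans (x0P _ Xx) _; apply: subset_sub_fin;
    exact: subsetUl.
  - move=> /sub_fin_trans /(_ (x0P _ Xx)) h; apply: Minf.
    apply: fin2 h (NX _ Xx0) _ => n Mn.
    by have [xn|xn] := pselect (x0 n); [right; split=> //; exact: MN|left;
      split; [right|]].
  - apply: fin2 (XY _ _ Xx0 Yy) (NY _ Yy) _ => n [[xn|Mn] yn]; first by left.
    by right; split=> //; exact: MN.
  - move=> h; apply: NMinf; apply: fin3 (NY _ Yy) h (NX _ Xx0) _ => n [Nn Mn].
    have [yn|yn] := pselect (y n); last by left; left.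
    have [xn|xn] := pselect (x0 n); first by right.
    by left; right; split=> // -[].
exists (y0 `\` M) => x y Xx Yy; split; split.
- apply: fin2 (XY _ _ Xx Yy0) (NX _ Xx) _ => n [xn cn].
  have [yn|yn] := pselect (y0 n); last by left.
  by right; split=> //; apply: MN; apply: contrapT => Mn; apply: cn.
- move=> h; apply: NMinf; apply: fin3 (NY _ Yy0) h (NX _ Xx) _ => n [Nn Mn].
  have [yn|yn] := pselect (y0 n); last by left; left.
  by have [xn|xn] := pselect (x n); [right|left; right].
- by apply: sub_fin_trans (y0P _ Yy); apply: subset_sub_fin => n [].
- move=> /(sub_fin_trans (y0P _ Yy)) h; apply: Minf.
  apply: fin2 (NY _ Yy0) h _ => n Mn.
  by have [yn|yn] := pselect (y0 n); [right; split=> // -[]|left; split=> //;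
    exact: MN].
Qed.

(** If [X] has a greatest or [Y] a least element modulo finite, the failure of a reverse inequality
    at every shift yields an infinite set for [fill_gap]. Otherwise [c] is read off [r], and the
    lack of extreme elements makes the inequalities strict. *)
Lemma sub_fin_interpolation (X Y : set (set nat)) (r : int -> int) :
  X !=set0 -> Y !=set0 -> (forall x y, X x -> Y y -> sub_fin x y) ->
  (forall x, X x -> strict seq_le (width x) r) ->
  (forall y, Y y -> strict seq_le r (width y)) ->
  exists c, forall x y, X x -> Y y -> strict sub_fin x c /\ strict sub_fin c y.
Proof.
move=> [x0 Xx0] [y0 Yy0] XY Xr rY.
(* A drop across a shift of about [K] needs a block that long, so the levels [n K] are unbounded.
   Their range is then infinite, almost disjoint from each [x] and almost contained in each [y]. *)
have fill (X' Y' : set (set nat)) (n : nat -> nat) :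
    X' !=set0 -> Y' !=set0 -> (forall x y, X' x -> Y' y ->
      exists l : nat, forall K, (l <= K)%N ->
        [/\ n K \notin x, n K \in y & (K < 4 ^ (n K).+1 + l)%N]) ->
    [/\ infinite_set (range n), forall x, X' x -> finite_set (range n `&` x) &
        forall y, Y' y -> finite_set (range n `\` y)].
  move=> [x X'x] [y Y'y] lP;
    split=> [/finite_nat_bounded[b bP]|x' X'x'|y' Y'y'].
  - have [l {}lP] := lP _ _ X'x Y'y; have [|_ _] := lP (4 ^ b + l)%N;
    first exact: leq_addl.
    have nb : (n (4 ^ b + l)%N < b)%N by apply: bP; exists (4 ^ b + l)%N.
    by rewrite ltn_add2r ltn_exp2l//; lia.
  - have [l {}lP] := lP _ _ X'x' Y'y.
    apply: (@sub_finite_set _ _ (n @` `I_l)); last exact/finite_image/finite_II.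
    move=> _ [[K _ <-] xn]; exists K => //=; rewrite ltnNge;
      apply/negP => /lP[].
    by rewrite mem_set.
  - have [l {}lP] := lP _ _ X'x Y'y'.
    apply: (@sub_finite_set _ _ (n @` `I_l)); last exact/finite_image/finite_II.
    move=> _ [[K _ <-] yn]; exists K => //=; rewrite ltnNge;
      apply/negP => /lP[_].
    by rewrite memNset.
have unbounded (s t : int -> int) : ~ seq_le s t ->
    forall K : nat, exists j : int, s j < t (j - K%:Z).
  move=> /forallNP nst K; have /existsNP[j /negP] := nst (- K%:Z).
  by rewrite -ltNge; exists j.
have [[x [Xx xP]]|noX] := pselect (exists x, X x /\ forall x', X x' ->
  sub_fin x' x).
  (* As [x] is fixed and [y] varies, the level is read at the index belonging to [x], which is
     independent of [y]; the case of a least [y] is dual. *)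
  have /choice[j jP] := unbounded _ _ (Xr _ Xx).2.
  have [||x' y -> Yy|Ninf NX NY] :=
    fill [set x] Y (fun K => level `|(j K - K%:Z)%R|); first by exists x.
  - by exists y0.
  - have [l lP] := (rY _ Yy).1; exists `|l|%N => K lK.
    have lt := le_lt_trans (lP (j K)) (jP K).
    have [|h1 h2 _ h3] := width_drop _ lt; first by lia.
    by split=> //; lia.
  apply: (fill_gap XY Ninf _ NY); last by left; exists x.
  move=> x' Xx'; apply: (@sub_finite_set _ _
      ((range (fun K => level `|(j K - K%:Z)%R|) `&` x) `|` (x' `\` x))).
    by move=> n [Nn x'n]; have [xn|xn] := pselect (x n); [left|right].
  by rewrite finite_setU; split; [exact: NX|exact: xP].
have [[y [Yy yP]]|noY] := pselect (exists y, Y y /\ forall y', Y y' ->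
  sub_fin y y').
  have /choice[j jP] := unbounded _ _ (rY _ Yy).2.
  have [||x y' Xx ->|Ninf NX NY] :=
    fill X [set y] (fun K => level `|j K|%N).
  - by exists x0.
  - by exists y.
  - have [l lP] := (Xr _ Xx).1; exists `|l|%N => K lK.
    have := lP (j K - K%:Z - l); rewrite subrK => h.
    have lt := lt_le_trans (jP K) h.
    have [|h1 h2 -> h3] := width_drop _ lt; first by lia.
    by split=> //; lia.
  apply: (fill_gap XY Ninf NX); last by right; exists y.
  move=> y' Yy'; apply: (@sub_finite_set _ _
      ((range (fun K => level `|j K|%N) `\` y) `|` (y `\` y'))).
    by move=> n [Nn yn]; have [y'n|y'n] := pselect (y n); [right|left].
  by rewrite finite_setU; split; [exact: NY|exact: yP].
(* The index [2 * 4 ^ n] stays in the [n]-th block under bounded shifts. *)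
exists [set n | r (2 * 4 ^ n)%N%:Z <= (2 * n + 2)%N%:Z].
set c := [set n | _].
have Xc x : X x -> sub_fin x c.
  move=> Xx; have [l lP] := (Xr _ Xx).1; apply/sub_finP;
    exists `|l|%N => n xn ln.
  have ln4 : (`|l| < 4 ^ n)%N by exact: leq_ltn_trans ln (ltn_expl n _).
  have := lP ((2 * 4 ^ n)%N%:Z - l); rewrite subrK => /le_trans; apply.
  have -> : (2 * 4 ^ n)%N%:Z - l = (`|((2 * 4 ^ n)%N%:Z - l)%R|%N)%:Z by lia.
  by rewrite (@width_level _ n) ?(mem_set xn)//; [lia|rewrite expnS; lia].
have cY y : Y y -> sub_fin c y.
  move=> Yy; have [l lP] := (rY _ Yy).1; apply/sub_finP;
    exists `|l|%N => n cn ln.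
  have ln4 : (`|l| < 4 ^ n)%N by exact: leq_ltn_trans ln (ltn_expl n _).
  have := le_trans (lP (2 * 4 ^ n)%N%:Z) cn.
  have -> : (2 * 4 ^ n)%N%:Z + l = (`|((2 * 4 ^ n)%N%:Z + l)%R|%N)%:Z by lia.
  rewrite (@width_level _ n); last by rewrite expnS; lia.
  by case: (boolP (n \in y)) => [/set_mem//|_] /=; lia.
move=> x y Xx Yy; split; split; [exact: Xc| |exact: cY|].
- move=> cx; apply: noX; exists x; split=> // x' Xx'.
  exact: sub_fin_trans (Xc _ Xx') cx.
- move=> yc; apply: noY; exists y; split=> // y' Yy'.
  exact: sub_fin_trans yc (cY _ Yy').
Qed.

(** The marks with distances [width a], normalised to 0 at index 0; the negative half-line has
    constant distance 2. *)
Definition positions (a : set nat) (j : int) : int :=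
  match j with
  | Posz n => \sum_(i < n) width a i%:Z
  | Negz n => - (2 * n.+1)%N%:Z
  end.

Lemma positions_step a (j : int) : positions a (j + 1) - positions a j = width a j.
Proof.
case: j => [n|[|n]].
- by rewrite -[1]/(1%:Z) -PoszD addn1 /= big_ord_recr/= addrAC subrr add0r.
- by rewrite /= big_ord0; lia.
- by rewrite (_ : Negz n.+1 + 1 = Negz n) /=; lia.
Qed.

Lemma positions_spaced a : spaced (positions a).
Proof.
move=> j; have := positions_step a j.
have : 2 <= width a j by case: j => [n|n] //=; lia.
by lia.
Qed.

Lemma positions_gap_le a b : gap_le (positions a) (positions b) <-> sub_fin a b.
Proof.
rewrite -width_seq_le; split=> -[k kP]; exists k => j; have := kP j;
  by rewrite !positions_step.
Qed.

(** * Gaps *)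

Lemma wset_borel (R : realType) (e : int -> R) P : grid e ->
  <<s [set U : set R | open U] >> (wset e P).
Proof.
move=> ge; pose G := [set U : set R | open U].
have openG (A : set R) : open A -> <<s G >> A by move=> oA;
  exact: sub_sigma_algebra.
(* The marked points are the complement of an open set: the grid intervals remove everything off the
   grid, and the neighbourhoods of unmarked grid points remove these. *)
have -> : wset e P =
    (\bigcup_(i in [set i | ~~ P i]) `]e i, e (i + 1)[%classic) `|`
    ~` ((\bigcup_(i in [set i | ~~ P i]) `]e (i - 1), e (i + 1)[%classic) `|`
        \bigcup_(i in setT) `]e i, e (i + 1)[%classic).
  apply/seteqP; split=> t.
    move=> [i [[Pi ->]|[Pi ti]]]; last by left; exists i; rewrite //= in_itv.
    right=> -[] [j Pj]; rewrite /= in_itv/= => /andP[h1 h2].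
      have := grid_lt_inv ge h1; have := grid_lt_inv ge h2 => h3 h4.
      by move/negP: Pj; apply; have <- : i = j by lia.
    by have := grid_lt_inv ge h1; have := grid_lt_inv ge h2; lia.
  move=> [[i Pi]|]; first by rewrite /= in_itv => ti; exists i; right.
  move=> nU; have [[i tE]|[i ti]] := grid_cases t ge; last first.
    by case: nU; right; exists i; rewrite //= in_itv.
  exists i; left; split=> //; apply: contrapT => /negP Pi; apply: nU.
  left; exists i => //=; rewrite in_itv/= tE !grid_lt//; lia.
have mU (A B : set R) : <<s G >> A -> <<s G >> B -> <<s G >> (A `|` B).
  by move=> mA mB; exact: (@measurableU _ (g_sigma_algebraType G)).
have mC (A : set R) : <<s G >> A -> <<s G >> (~` A).
  by move=> mA; exact: (@measurableC _ (g_sigma_algebraType G)).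
by apply: (mU); [|apply: mC; apply: (mU)]; apply: openG;
  apply: bigcup_open => i _;
  exact: interval_open.
Qed.

Definition line_borel (R : realType) (p : int -> int) : borel_set R :=
  exist _ (line_set p) (wset_borel (mark p) (zgridP R)).

Lemma line_borel_le (R : realType) a b :
  wadge_le (line_borel R (positions a)) (line_borel R (positions b)) <->
  sub_fin a b.
Proof.
rewrite -positions_gap_le -(line_set_reduces R (positions_spaced a) (positions_spaced b)).
by [].
Qed.

Lemma line_borel_strict (R : realType) a b : strict sub_fin a b ->
  strict (@wadge_le R) (line_borel R (positions a)) (line_borel R (positions b)).
Proof. by move=> [ab ba]; split; [exact/line_borel_le|move/line_borel_le]. Qed.

Lemma seq_le_gap p q :
  gap_le p q <-> seq_le (fun j => p (j + 1) - p j) (fun j => q (j + 1) - q j).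
Proof. by []. Qed.

(** By convexity a set [C] filling the image would be equivalent to some [line_set r]; the distances
    of [r] would lie strictly between the widths of both sides, and interpolation would fill the
    original gap. *)
Lemma line_borel_gap (R : realType) (X Y : set (set nat)) : is_gap sub_fin X Y ->
  is_gap (@wadge_le R) ((fun a => line_borel R (positions a)) @` X)
    ((fun a => line_borel R (positions a)) @` Y).
Proof.
move=> [[x0 Xx0] [y0 Yy0] XY noc]; split.
- by exists (line_borel R (positions x0)); exists x0.
- by exists (line_borel R (positions y0)); exists y0.
- by move=> _ _ [x Xx <-] [y Yy <-]; apply/line_borel_strict/XY.
move=> [C CP]; have XC x : X x ->
  strict (@wadge_le R) (line_borel R (positions x)) C.
  by move=> Xx; apply: (CP _ (line_borel R (positions y0)) _ _).1;
    [exists x|exists y0].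
have CY y : Y y -> strict (@wadge_le R) C (line_borel R (positions y)).
  by move=> Yy; apply: (CP (line_borel R (positions x0)) _ _ _).2;
    [exists x0|exists y].
have [g gr] := (XC _ Xx0).1; have [f fr] := (CY _ Yy0).1.
have [r [sr Cr rC]] := line_set_convex (positions_spaced x0) (positions_spaced y0) gr fr.
have leC a : wadge_le (line_borel R (positions a)) C <->
    seq_le (width a) (fun j => r (j + 1) - r j).
  have -> : width a = fun j => positions a (j + 1) - positions a j.
    by apply/funext => j; rewrite positions_step.
  rewrite -seq_le_gap -(line_set_reduces R (positions_spaced a) sr).
  split=> -[h hr].
    by have [k kr] := Cr; exists (k \o h); exact: reduces_comp kr.
  by have [k kr] := rC; exists (k \o h); exact: reduces_comp kr.
have Cle a : wadge_le C (line_borel R (positions a)) <->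
    seq_le (fun j => r (j + 1) - r j) (width a).
  have -> : width a = fun j => positions a (j + 1) - positions a j.
    by apply/funext => j; rewrite positions_step.
  rewrite -seq_le_gap -(line_set_reduces R sr (positions_spaced a)).
  split=> -[h hr].
    by have [k kr] := rC; exists (h \o k); exact: reduces_comp hr.
  by have [k kr] := Cr; exists (h \o k); exact: reduces_comp hr.
apply: noc; apply: (@sub_fin_interpolation X Y (fun j => r (j + 1) - r j)).
- by exists x0.
- by exists y0.
- by move=> x y Xx Yy; exact: (XY _ _ Xx Yy).1.
- by move=> x /XC[h1 h2]; split; [exact/leC|move/Cle].
- by move=> y /CY[h1 h2]; split; [exact/Cle|move/leC].
Qed.

Theorem theorem1p7 (R : realType)
    (K : Type) (leK : rel K) (L : Type) (leL : rel L)
    (K_card : is_cardinal leK) (L_card : is_cardinal leL)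
    (K_ge1 : [set: K] !=set0) (L_ge1 : [set: L] !=set0) :
  (exists X Y : set (set nat), is_card_gap leK leL sub_fin X Y) ->
  exists X Y : set (borel_set R), is_card_gap leK leL (@wadge_le R) X Y.
Proof.
move=> [X [Y [gapXY [x [XE x_lt]] [y [YE y_lt]]]]].
pose F a := line_borel R (positions a).
exists (F @` X), (F @` Y); split.
- exact: line_borel_gap.
- exists (F \o x); split; first by rewrite XE image_comp.
  by move=> a b /x_lt; exact: line_borel_strict.
- exists (F \o y); split; first by rewrite YE image_comp.
  by move=> a b /y_lt; exact: line_borel_strict.
Qed.
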